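(* Let $X$ be a Baire space, $\lambda$ a nonzero cardinal, and suppose $X$ is Baire $\lambda$-resolvable. (1) If $\lambda\ge\omega$, then $\mathsf{S5}^\lambda$ is sound and strongly complete for $\mathbf{Baire}(X)$. (2) If $\lambda<\omega$ and no nonempty open subset of $X$ is Baire $(\lambda+1)$-resolvable, then $\mathsf{S5}_\lambda$ is sound and strongly complete for $\mathbf{Baire}(X)$.
   Context: Meager = countable union of nowhere dense sets; Baire space: no nonempty open set is meager. A set $Y$ (subspace) is Baire $\kappa$-resolvable if it has a partition $\{A_\iota:\iota<\kappa\}$ with each $A_\iota\cap V$ non-meager for every nonempty open $V\subseteq Y$. $\mathbf{Baire}(X)$ is the closure algebra whose underlying Boolean algebra is $\wp(X)$ modulo meager sets, with $\mathbf c a$ the least class $[F]$, $F$ closed, above $a$. Modal formulas over variables $\{p_\iota:\iota<\lambda\}$ are built from $\wedge,\neg,\Diamond$ ($\Box=\neg\Diamond\neg$). A valuation in a closure algebra $B$ assigns elements to variables and extends by $\wedge\mapsto$ meet, $\neg\mapsto$ complement, $\Diamond\mapsto\mathbf c$; $B\models\varphi$ if every valuation sends $\varphi$ to $1$; $\Gamma\models_B\varphi$ means $B\models\Gamma$ implies $B\models\varphi$. $\mathsf{S5}^\lambda$ (over $\lambda$ variables) is axiomatized by propositional tautologies, $\Diamond(p\vee q)\to\Diamond p\vee\Diamond q$, $p\to\Diamond p$, $\Diamond\Diamond p\to\Diamond p$, $\neg\Diamond\bot$, $\Diamond p\to\Box\Diamond p$, with rules substitution, modus ponens and monotonicity (from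 $\varphi\to\psi$ infer $\Diamond\varphi\to\Diamond\psi$); for $n\ge1$, $\mathsf{S5}_n$ is $\mathsf{S5}$ (countably many variables) plus $\bigwedge_{i=1}^{n+1}\Diamond p_i\to\bigvee_{1\le i<j\le n+1}\Diamond(p_i\wedge p_j)$. $\Gamma\vdash_\Lambda\varphi$: $\varphi$ is derivable in $\Lambda$ using $\Gamma$ as extra axioms. $\Lambda$ is sound for $B$ if every theorem of $\Lambda$ is valid in $B$, strongly complete for $B$ if $\Gamma\models_B\varphi$ implies $\Gamma\vdash_\Lambda\varphi$.
   Formalization: Γ ⊨_B φ is read per valuation (each valuation sending all of Γ to 1 sends φ to 1), since the literal reading makes strong completeness false for λ≥2; in Γ ⊢ φ substitution is not applied to premises; partition blocks are nonempty, so X is nonempty. *)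

(* Defs.v *)
From HB Require Import structures.
From mathcomp Require Import all_boot all_order.
From mathcomp Require Import all_classical topology.

Set Implicit Arguments.
Unset Strict Implicit.
Unset Printing Implicit Defensive.

Import Order.TTheory.
Local Open Scope classical_set_scope.
Local Open Scope quotient_scope.

Section Category.
Context {X : topologicalType}.
Implicit Types A B U V W : set X.

Definition nowhere_dense A := interior (closure A) = set0.

Definition meager A :=
  exists2 F : nat -> set X, forall n, nowhere_dense (F n) & A = \bigcup_n F n.

Lemma nowhere_denseP A : nowhere_dense A <->
  forall U, open U -> U !=set0 ->
    exists V, [/\ open V, V !=set0, V `<=` U & V `&` A = set0].
Proof.
split=> [ndA U oU [x Ux]|H].
  exists (U `&` ~` closure A); split.
  - by apply: openI => //; apply: closed_openC; exact: closed_closure.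
  - apply: contrapT => /set0P/negP/negPn/eqP E.
    have UA : U `<=` closure A.
      move=> y Uy; apply: contrapT => nA.
      by have : (U `&` ~` closure A) y by []; rewrite E.
    have : interior (closure A) x by rewrite /interior nbhsE; exists U.
    by rewrite ndA.
  - by move=> y [].
  - apply/seteqP; split=> // y [[_ nA] Ay].
    by apply: nA; exact: subset_closure.
apply/seteqP; split=> // x xA.
have [V [oV [y Vy] VA VA0]] := H _ (open_interior (closure A)) (ex_intro _ x xA).
have [z [Az Vz]] := interior_subset (VA _ Vy) _ (open_nbhs_nbhs (conj oV Vy)).
have : (V `&` A) z by [].
by rewrite VA0.
Qed.

Lemma nowhere_denseS A B : A `<=` B -> nowhere_dense B -> nowhere_dense A.
Proof.
move=> AB ndB; apply/seteqP; split=> // x.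
by move=> /(interiorS (closureS AB)); rewrite ndB.
Qed.

Lemma nowhere_dense_meager A : nowhere_dense A -> meager A.
Proof. by move=> ndA; exists (fun=> A) => //; rewrite bigcup_const//; exists 0. Qed.

Lemma meagerS A B : A `<=` B -> meager B -> meager A.
Proof.
move=> AB [F ndF BF]; exists (fun n => A `&` F n).
  by move=> n; apply: nowhere_denseS (ndF n) => x [].
by rewrite -setI_bigcupr -BF; apply/esym/setIidl.
Qed.

Lemma meager0 : meager set0.
Proof.
apply: nowhere_dense_meager; rewrite /nowhere_dense closure0.
by apply/seteqP; split=> // x /interior_subset.
Qed.

Lemma meagerU A B : meager A -> meager B -> meager (A `|` B).
Proof.
move=> [F ndF ->] [G ndG ->].
exists (fun n => if odd n then F n./2 else G n./2).
  by move=> n; case: ifP.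
apply/seteqP; split=> [x [[n _ Fx]|[n _ Gx]]|x [n _]].
- by exists n.*2.+1 => //=; rewrite odd_double /= uphalf_double.
- by exists n.*2 => //=; rewrite odd_double /= doubleK.
- by case: ifP => _ Hx; [left|right]; exists n./2.
Qed.

Definition baire_space := forall U, open U -> U !=set0 -> ~ meager U.

Definition meager_part A := \bigcup_(U in [set U | open U /\ meager (A `&` U)]) U.

(* The Banach category theorem. *)
Lemma meager_meager_part A : meager (A `&` meager_part A).
Proof.
pose D := [set U : set X | [/\ open U, U !=set0 & meager (A `&` U)]].
have [G [GD tG maxG]] := ex_maximal_disjoint_subcollection (fun U : set X => U) D.
pose V := \bigcup_(U in G) U.
have oV : open V by apply: bigcup_open => U /GD[].
have WV : meager_part A `<=` closure V.
  move=> x [U [oU mU] Ux]; apply: contrapT => nVx.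
  pose U' := U `&` ~` closure V.
  have U'x : U' x by [].
  have VU' W : G W -> W `&` U' = set0.
    move=> GW; apply/seteqP; split=> // y [Wy [_]]; apply.
    by apply: subset_closure; exists W.
  have nGU' : ~ G U' by move=> /VU'; rewrite setIid => E; rewrite E in U'x.
  apply: (maxG (G `|` [set U'])).
  - split; last by move=> /(_ U') H; apply/nGU'/H; right.
    by move=> W; left.
  - move=> W [/GD//|->]; split; last 2 first.
    + by exists x.
    + by apply: meagerS mU => y [? []].
    by apply: openI => //; apply: closed_openC; exact: closed_closure.
  - move=> S T [GS|->] [GT|->]// [y [Sy Ty]].
    + by apply: tG => //; exists y.
    + by have := VU' _ GS; move=> /seteqP[/(_ y)] /(_ (conj Sy Ty)).
    + by have := VU' _ GT; move=> /seteqP[/(_ y)] /(_ (conj Ty Sy)).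
have ndV : nowhere_dense (closure V `\` V).
  apply/nowhere_denseP => U oU [x Ux].
  have [[y [Vy Uy]]|UV0] := pselect ((V `&` U) !=set0).
    exists (V `&` U); split; [exact: openI|by exists y|by move=> z []|].
    by apply/seteqP; split=> // z [[Vz _] [_]].
  exists U; split=> //; first by exists x.
  apply/seteqP; split=> // z [Uz [Vz _]].
  have [w [Vw Uw]] := Vz _ (open_nbhs_nbhs (conj oU Uz)).
  by apply: UV0; exists w.
have /choice[F FP] : forall U, exists f : nat -> set X, G U ->
    (forall n, nowhere_dense (f n)) /\ A `&` U = \bigcup_n f n.
  move=> U; have [/GD[_ _ [f ndf ->]]|] := pselect (G U); first by exists f.
  by exists (fun=> set0).
have mAV : meager (A `&` V).
  exists (fun n => \bigcup_(U in G) F U n); last first.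
    rewrite setI_bigcupr; apply/seteqP; split=> [x [U GU AUx]|x [n _ [U GU Fx]]].
      by move: AUx; rewrite (FP _ GU).2 => -[n _ Fx]; exists n => //; exists U.
    by exists U => //; rewrite (FP _ GU).2; exists n.
  have FU U n : G U -> F U n `<=` U.
    move=> GU x Fx.
    by have [] : (A `&` U) x by rewrite (FP _ GU).2; exists n.
  move=> n; apply/nowhere_denseP => U oU U0.
  have [[y [[S GS Sy] Uy]]|UV0] := pselect ((V `&` U) !=set0); last first.
    exists U; split=> //; apply/seteqP; split=> // z [Uz [S GS Fz]].
    by apply: UV0; exists z; split=> //; exists S => //; exact: FU Fz.
  have [oS _ _] := GD _ GS.
  have /nowhere_denseP/(_ (S `&` U) (openI oS oU)) := (FP _ GS).1 n.
  case; first by exists y.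
  move=> T [oT T0 TSU TF]; exists T; split=> //; first by move=> z /TSU[].
  apply/seteqP; split=> // z [Tz [S' GS' Fz]].
  have SS' : S = S'.
    by apply: tG => //; exists z; split; [have [] := TSU _ Tz|exact: FU Fz].
  have : (T `&` F S n) z by split=> //; rewrite SS'.
  by rewrite TF.
apply: (meagerS _ (meagerU mAV (nowhere_dense_meager ndV))).
move=> x [Ax /WV Vx]; have [|nVx] := pselect (V x); first by left.
by right.
Qed.

End Category.

Arguments baire_space : clear implicits.

(* A partition has nonempty blocks, so an empty space has none. *)
Definition baire_resolvable (K : Type) (Y : topologicalType) :=
  exists2 A : K -> set Y, partition [set: K] A [set: Y] &
    forall (k : K) (V : set Y), open V -> V !=set0 -> ~ meager (A k `&` V).

HB.mixin Record isClosureAlgebra (d : Order.disp_t) T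
    of Order.CTBDistrLattice d T := {
  clop : T -> T;
  clop0 : clop \bot%O = \bot%O;
  le_clop : forall a, (a <= clop a)%O;
  clop_idem : forall a, clop (clop a) = clop a;
  clopU : forall a b, clop (a `|` b)%O = (clop a `|` clop b)%O
}.

#[short(type="closureAlgType")]
HB.structure Definition ClosureAlgebra (d : Order.disp_t) :=
  {T of Order.CTBDistrLattice d T & isClosureAlgebra d T}.

Section BaireAlgebra.
Variable X : topologicalType.
Implicit Types A B : set X.

Definition meager_eq (A B : set X) : bool := `[< meager (A `+` B) >].

Fact meager_eq_refl : reflexive meager_eq.
Proof. by move=> A; apply/asboolP; rewrite setYK; exact: meager0. Qed.

Fact meager_eq_sym : symmetric meager_eq.
Proof. by move=> A B; rewrite /meager_eq setYC. Qed.

Fact meager_eq_trans : transitive meager_eq.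
Proof.
move=> B A C /asboolP mAB /asboolP mBC; apply/asboolP.
apply: meagerS (meagerU mAB mBC) => x.
have [Bx|nBx] := pselect (B x).
  by case=> -[? ?]; [right; left|left; right].
by case=> -[? ?]; [left; left|right; right].
Qed.

Canonical meager_equiv :=
  EquivRel meager_eq meager_eq_refl meager_eq_sym meager_eq_trans.

Definition baire_algebra := {eq_quot meager_equiv}.

HB.instance Definition _ := Choice.on baire_algebra.
HB.instance Definition _ := EqQuotient.on baire_algebra.

Definition baire_class (A : set X) : baire_algebra := \pi A.

Lemma baire_classP A B : baire_class A = baire_class B <-> meager (A `+` B).
Proof.
split=> [/eqmodP/asboolP//|mAB]; exact/eqmodP/asboolP.
Qed.

Lemma baire_class_ind (P : baire_algebra -> Prop) :
  (forall A, P (baire_class A)) -> forall a, P a.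
Proof. by move=> H a; rewrite -[a]reprK. Qed.

Let repr_class A : meager (repr (baire_class A) `+` A).
Proof. by apply/baire_classP; rewrite /baire_class reprK. Qed.

Definition baire_meet (a b : baire_algebra) := baire_class (repr a `&` repr b).
Definition baire_join (a b : baire_algebra) := baire_class (repr a `|` repr b).
Definition baire_compl (a : baire_algebra) := baire_class (~` repr a).
Definition baire_le (a b : baire_algebra) := baire_meet a b == a.
Definition baire_lt (a b : baire_algebra) := (b != a) && baire_le a b.

Lemma baire_meetE A B :
  baire_meet (baire_class A) (baire_class B) = baire_class (A `&` B).
Proof.
apply/baire_classP.
apply: meagerS (meagerU (repr_class A) (repr_class B)) => x.
have [Ax|nAx] := pselect (repr (baire_class A) x);
have [Bx|nBx] := pselect (repr (baire_class B) x);
case=> [[[? ?] /not_andP[]]|[[? ?] /not_andP[]]] ?;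
  by [|left; left|left; right|right; left|right; right].
Qed.

Lemma baire_joinE A B :
  baire_join (baire_class A) (baire_class B) = baire_class (A `|` B).
Proof.
apply/baire_classP.
apply: meagerS (meagerU (repr_class A) (repr_class B)) => x.
by case=> -[[?|?] /not_orP[? ?]];
  [left; left|right; left|left; right|right; right].
Qed.

Lemma baire_complE A : baire_compl (baire_class A) = baire_class (~` A).
Proof.
apply/baire_classP; apply: meagerS (repr_class A) => x.
by case=> -[? /contrapT ?]; [right|left].
Qed.

Let meetC : commutative baire_meet.
Proof. by move=> a b; rewrite /baire_meet setIC. Qed.

Let joinC : commutative baire_join.
Proof. by move=> a b; rewrite /baire_join setUC. Qed.

Let meetA : associative baire_meet.
Proof.
elim/baire_class_ind=> A; elim/baire_class_ind=> B; elim/baire_class_ind=> C.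
by rewrite !baire_meetE setIA.
Qed.

Let joinA : associative baire_join.
Proof.
elim/baire_class_ind=> A; elim/baire_class_ind=> B; elim/baire_class_ind=> C.
by rewrite !baire_joinE setUA.
Qed.

Let joinKI b a : baire_meet a (baire_join a b) = a.
Proof.
elim/baire_class_ind: a => A; elim/baire_class_ind: b => B.
by rewrite baire_joinE baire_meetE (setUC A) setKU.
Qed.

Let meetKU b a : baire_join a (baire_meet a b) = a.
Proof.
elim/baire_class_ind: a => A; elim/baire_class_ind: b => B.
by rewrite baire_meetE baire_joinE (setIC A) setKI.
Qed.

Let meetUl : left_distributive baire_meet baire_join.
Proof.
elim/baire_class_ind=> A; elim/baire_class_ind=> B; elim/baire_class_ind=> C.
by rewrite !(baire_meetE, baire_joinE) setIUl.
Qed.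

Let meetxx : idempotent_op baire_meet.
Proof. by elim/baire_class_ind=> A; rewrite baire_meetE setIid. Qed.

Fact baire_display : Order.disp_t. Proof. by []. Qed.

HB.instance Definition _ :=
  Order.isMeetJoinDistrLattice.Build baire_display baire_algebra
    (fun _ _ => erefl) (fun _ _ => erefl)
    meetC joinC meetA joinA joinKI meetKU meetUl meetxx.

Lemma baire_leP A B :
  reflect (meager (A `\` B)) (baire_class A <= baire_class B)%O.
Proof.
rewrite /Order.le/= /baire_le baire_meetE.
apply: (iffP eqP) => [/baire_classP|mAB].
  by apply: meagerS => x [Ax nBx]; right; split=> // -[].
apply/baire_classP; apply: meagerS mAB => x [[[]//]|[Ax nAB]].
by split=> // Bx; exact: nAB.
Qed.

Let le0x a : (baire_class set0 <= a)%O.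
Proof.
by elim/baire_class_ind: a => A; apply/baire_leP; rewrite set0D; exact: meager0.
Qed.

Let lex1 a : (a <= baire_class [set: X])%O.
Proof.
by elim/baire_class_ind: a => A; apply/baire_leP; rewrite setDT; exact: meager0.
Qed.

HB.instance Definition _ :=
  Order.hasBottom.Build baire_display baire_algebra le0x.
HB.instance Definition _ :=
  Order.hasTop.Build baire_display baire_algebra lex1.

Let joinxC (a : baire_algebra) : (a `|` baire_compl a)%O = \top%O.
Proof.
elim/baire_class_ind: a => A.
by rewrite baire_complE /Order.join/= baire_joinE setUCr.
Qed.

Let meetxC (a : baire_algebra) : (a `&` baire_compl a)%O = \bot%O.
Proof.
elim/baire_class_ind: a => A.
by rewrite baire_complE /Order.meet/= baire_meetE setICr.
Qed.

HB.instance Definition _ :=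
  Order.TBDistrLattice_hasComplement.Build baire_display baire_algebra
    joinxC meetxC.

Definition closed_classes_above (a : baire_algebra) : set baire_algebra :=
  [set baire_class F | F in [set F | closed F /\ (a <= baire_class F)%O]].

Definition is_baire_closure (a b : baire_algebra) :=
  closed_classes_above a b /\ lbound (closed_classes_above a) b.

(* The default value is never used, by baire_closureP. *)
Definition baire_closure (a : baire_algebra) : baire_algebra :=
  xget \top%O [set b | is_baire_closure a b].

Lemma is_baire_closureE A :
  is_baire_closure (baire_class A) (baire_class (~` meager_part A)).
Proof.
split.
  exists (~` meager_part A) => //; split.
    by apply: open_closedC; apply: bigcup_open => U [].
  by apply/baire_leP; rewrite setDE setCK; exact: meager_meager_part.
move=> _ [F [cF /baire_leP mF] <-]; apply/baire_leP.
apply: meagerS meager0 => x [nWx nFx]; apply: nWx.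
by exists (~` F) => //; split; [exact: closed_openC|rewrite -setDE].
Qed.

Lemma baire_closureP a : is_baire_closure a (baire_closure a).
Proof.
rewrite /baire_closure; case: xgetP => [b _ //|/= H].
elim/baire_class_ind: a H => A H.
by case: (H _ (is_baire_closureE A)).
Qed.

Let le_closure a : (a <= baire_closure a)%O.
Proof. by have [[F [_ ?] <-] _] := baire_closureP a. Qed.

Let closure_le a F : closed F -> (a <= baire_class F)%O ->
  (baire_closure a <= baire_class F)%O.
Proof. by have [_ lb] := baire_closureP a; move=> cF aF; apply: lb; exists F. Qed.

Let closure0 : baire_closure \bot%O = \bot%O.
Proof.
by apply/eqP; rewrite -lex0; apply: (@closure_le _ set0) => //; exact: closed0.
Qed.

Let closure_idem a : baire_closure (baire_closure a) = baire_closure a.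
Proof.
apply/eqP; rewrite eq_le le_closure andbT.
have [[F [cF _] FE] _] := baire_closureP a.
by rewrite -[leRHS]FE; apply: closure_le => //; rewrite FE.
Qed.

Let closureU a b :
  baire_closure (a `|` b)%O = (baire_closure a `|` baire_closure b)%O.
Proof.
apply/eqP; rewrite eq_le; apply/andP; split.
  have [[F [cF aF] FE] _] := baire_closureP a.
  have [[G [cG bG] GE] _] := baire_closureP b.
  rewrite -FE -GE {2}/Order.join/= baire_joinE; apply: closure_le.
    exact: closedU.
  by rewrite -baire_joinE; exact: leU2.
have [[H [cH abH] HE] _] := baire_closureP (a `|` b)%O.
rewrite -HE leUx; apply/andP; split; apply: closure_le => //.
  by apply: le_trans abH; exact: leUl.
by apply: le_trans abH; exact: leUr.
Qed.

HB.instance Definition _ :=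
  isClosureAlgebra.Build baire_display baire_algebra
    closure0 le_closure closure_idem closureU.

End BaireAlgebra.

Inductive formula (V : Type) : Type :=
| Var of V
| And of formula V & formula V
| Neg of formula V
| Dia of formula V.

Arguments Var {V}.
Arguments And {V}.
Arguments Neg {V}.
Arguments Dia {V}.

Section Formulas.
Context {V : Type}.
Implicit Types f g : formula V.

Definition Or f g := Neg (And (Neg f) (Neg g)).
Definition Imp f g := Or (Neg f) g.
Definition Box f := Neg (Dia (Neg f)).

(* The language has no constants: falsum and verum are expressed by means of
   an arbitrary variable p. *)
Definition Bot (p : V) := And (Var p) (Neg (Var p)).
Definition Top (p : V) := Neg (Bot p).

Fixpoint subst (s : V -> formula V) f : formula V :=
  match f with
  | Var p => s p
  | And g h => And (subst s g) (subst s h)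
  | Neg g => Neg (subst s g)
  | Dia g => Dia (subst s g)
  end.

(* Formulas of the form Dia g are treated as atoms. *)
Definition tautology f :=
  forall e : formula V -> bool,
    (forall g h, e (And g h) = e g && e h) -> (forall g, e (Neg g) = ~~ e g) ->
    e f.

Inductive S5_axiom : set (formula V) :=
| S5_taut f : tautology f -> S5_axiom f
| S5_add (p q : V) :
    S5_axiom (Imp (Dia (Or (Var p) (Var q))) (Or (Dia (Var p)) (Dia (Var q))))
| S5_refl (p : V) : S5_axiom (Imp (Var p) (Dia (Var p)))
| S5_trans (p : V) : S5_axiom (Imp (Dia (Dia (Var p))) (Dia (Var p)))
| S5_bot (p : V) : S5_axiom (Neg (Dia (Bot p)))
| S5_eucl (p : V) : S5_axiom (Imp (Dia (Var p)) (Box (Dia (Var p)))).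

Inductive theorems (Ax : set (formula V)) : set (formula V) :=
| thm_ax f : Ax f -> theorems Ax f
| thm_subst s f : theorems Ax f -> theorems Ax (subst s f)
| thm_mp f g : theorems Ax (Imp f g) -> theorems Ax f -> theorems Ax g
| thm_mono f g : theorems Ax (Imp f g) -> theorems Ax (Imp (Dia f) (Dia g)).

(* L is the set of theorems of a logic, already closed under substitution.
   Substitution is not applied to formulas that depend on the premises G. *)
Inductive derivable (L G : set (formula V)) : set (formula V) :=
| der_thm f : L f -> derivable L G f
| der_prem f : G f -> derivable L G f
| der_mp f g : derivable L G (Imp f g) -> derivable L G f -> derivable L G g
| der_mono f g : derivable L G (Imp f g) -> derivable L G (Imp (Dia f) (Dia g)).

Section Semantics.
Context {d : Order.disp_t} (B : closureAlgType d).

Fixpoint eval (v : V -> B) f : B :=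
  match f with
  | Var p => v p
  | And g h => (eval v g `&` eval v h)%O
  | Neg g => (~` eval v g)%O
  | Dia g => clop (eval v g)
  end.

Definition valid f := forall v : V -> B, eval v f = \top%O.

(* Premises and conclusion are evaluated under the same valuation. With
   "all of G is valid in B implies f is valid in B" instead, strong completeness
   would fail: any G that is not valid in B would entail falsum. *)
Definition consequence (G : set (formula V)) f :=
  forall v : V -> B, (forall g, G g -> eval v g = \top%O) -> eval v f = \top%O.

Definition sound (L : set (formula V)) := forall f, L f -> valid f.

Definition strongly_complete (L : set (formula V)) :=
  forall G f, consequence G f -> derivable L G f.

End Semantics.
End Formulas.

Definition S5 (V : Type) : set (formula V) := theorems S5_axiom.

Arguments S5 : clear implicits.

Definition bounded_axiom (n : nat) : formula nat :=
  Imp (\big[And/Top 0]_(1 <= i < n.+2) Dia (Var i))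
      (\big[Or/Bot 0]_(1 <= i < n.+2)
         \big[Or/Bot 0]_(i.+1 <= j < n.+2) Dia (And (Var i) (Var j))).

Definition S5_bounded (n : nat) : set (formula nat) :=
  theorems (S5_axiom `|` [set bounded_axiom n]).

(* Main.v *)
(* A closed set differs from its interior by a nowhere dense set, so modulo
   meager sets closed elements are open, which is the S5 axiom; n + 1 sets that
   refute the bounded axiom are, on some nonempty open W, everywhere non-meager
   and pairwise disjoint modulo meager sets, and thus resolve W into n + 1
   pieces.

   For completeness, if G does not prove f, extend the theory of G to a complete
   theory w0 omitting f, and consider the complete theories w that extend the
   theory of G and contain the same formulas Dia g as w0. A subfamily (w_k)
   indexed by K that has a witness g \in w_k for each Dia g \in w0, together
   with a Baire resolution (A_k) of X, gives the valuation sending p to the class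
   of the union of the A_k with p \in w_k; then every formula g is sent to the
   class of the union of the A_k with g \in w_k. If K is infinite there are no more
   formulas than elements of K, since K x K embeds in K; if K has n elements the
   bounded axiom leaves room for at most n such theories w. *)

Require Import Defs.
From HB Require Import structures.
From mathcomp Require Import all_boot all_order.
From mathcomp Require Import all_classical topology.

Set Implicit Arguments.
Unset Strict Implicit.
Unset Printing Implicit Defensive.

Import Order.Theory.
Local Open Scope classical_set_scope.
Local Open Scope card_scope.

(* topology has another [eval], on function spaces. *)
Local Notation eval := Defs.eval.

Lemma Zorn_bigcup_above (T : Type) (P : set (set T)) (A0 : set T) :
  P A0 ->
  (forall F : set (set T), F !=set0 -> F `<=` P -> total_on F subset ->
    P (\bigcup_(X in F) X)) ->
  exists A, [/\ A0 `<=` A, P A & forall B, A `<` B -> ~ P B].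
Proof.
move=> PA0 Pchain; pose Q := [set A | A = set0 \/ (A0 `<=` A /\ P A)].
have [F FQ totF|A [QA maxA]] := @Zorn_bigcup T Q.
  have [[Y [FY Y0]]|allE] := pselect (exists Y, F Y /\ Y <> set0); last first.
    left; apply/seteqP; split=> // x [Y FY Yx].
    have Y0 : Y = set0 by apply: contrapT => Y0; apply: allE; exists Y.
    by rewrite Y0 in Yx.
  right; pose F' := F `&` [set Z | Z <> set0].
  have FF' : \bigcup_(Z in F) Z = \bigcup_(Z in F') Z.
    apply/seteqP; split=> x [Z]; last by move=> [FZ _] Zx; exists Z.
    by move=> FZ Zx; exists Z => //; split=> // Z0; rewrite Z0 in Zx.
  have F'Q Z : F' Z -> A0 `<=` Z /\ P Z by move=> [FZ ZN]; case: (FQ _ FZ).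
  split.
    have [A0Y _] := F'Q Y (conj FY Y0).
    by move=> x A0x; exists Y => //; exact: A0Y.
  rewrite FF'; apply: Pchain.
  - by exists Y; split.
  - by move=> Z /F'Q[].
  - by move=> Y1 Y2 [FY1 _] [FY2 _]; exact: totF.
case: (QA) => [A_0|[A0A PA]]; last first.
  exists A; split=> // B AB PB; apply: (maxA _ AB); right; split=> //.
  by apply: subset_trans A0A _; case: AB.
have A00 : A0 = set0.
  apply: contrapT => A0N; apply: (maxA A0); last by right; split.
  rewrite A_0; split=> [x []|A0S]; apply: A0N.
  by apply/seteqP; split=> // x [].
exists A; split; [by rewrite A00|by rewrite A_0 -A00|move=> B AB PB].
by apply: (maxA B AB); right; split=> //; rewrite A00.
Qed.

Definition injects T U (A : set T) (B : set U) :=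
  exists f : T -> U, (forall x, A x -> B (f x)) /\
    (forall x y, A x -> A y -> f x = f y -> x = y).

Lemma injects_total T U (A : set T) (B : set U) : T -> U ->
  injects A B \/ injects B A.
Proof.
move=> t0 u0.
pose P := [set R : set (T * U) | (R `<=` A `*` B) /\
  (forall p q, R p -> R q -> (p.1 = q.1 <-> p.2 = q.2))].
have [||R [_ [RAB Rinj] maxR]] := @Zorn_bigcup_above _ P set0.
- by split.
- move=> F F0 FP totF.
  split=> [p [R /FP[RAB _] /RAB]//|p q [R FR Rp] [S FS Sq]].
  have [RS|SR] := totF _ _ FR FS.
    by apply: (FP _ FS).2 => //; exact: RS.
  by apply: (FP _ FR).2 => //; exact: SR.
have [domR|ndomR] := pselect (forall x, A x -> exists y, R (x, y)).
  left; have /choice[f fP] : forall x, exists y, A x -> R (x, y).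
    move=> x; have [/domR[y Rxy]|nAx] := pselect (A x); first by exists y.
    by exists u0.
  exists f; split=> [x /fP/RAB[]//|x y /fP Rx /fP Ry].
  by rewrite -(Rinj _ _ Rx Ry).
have [ranR|nranR] := pselect (forall y, B y -> exists x, R (x, y)).
  right; have /choice[f fP] : forall y, exists x, B y -> R (x, y).
    move=> y; have [/ranR[x Rxy]|nBy] := pselect (B y); first by exists x.
    by exists t0.
  exists f; split=> [y /fP/RAB[]//|x y /fP Rx /fP Ry].
  by rewrite (Rinj _ _ Rx Ry).
have [x /not_implyP[Ax nRx]] := (existsNP _).2 ndomR.
have [y /not_implyP[By nRy]] := (existsNP _).2 nranR.
exfalso; apply: (maxR (R `|` [set (x, y)])).
  by split=> [p|/(_ (x, y)) H]; [left|apply: nRx; exists y; apply: H; right].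
split=> [p [/RAB//|->]//|[p1 p2] [q1 q2] [Rp|[-> ->]] [Rq|[-> ->]]//=].
- exact: (Rinj _ _ Rp Rq).
- split=> E; exfalso; first by apply: nRx; exists p2; rewrite -E.
  by apply: nRy; exists p1; rewrite -E.
- split=> E; exfalso; first by apply: nRx; exists q2; rewrite E.
  by apply: nRy; exists q1; rewrite E.
Qed.

Lemma infinite_nat_injection (K : Type) :
  infinite_set [set: K] -> exists i : nat -> K, injective i.
Proof.
move=> /infiniteP/card_leP[i0].
exists (fun n => val (i0 (exist _ n (mem_set I)))) => m n /val_inj E.
by have := @inj _ _ _ i0 _ _ (mem_set I) (mem_set I) E; case.
Qed.

Section Squares.
Variable K : Type.

Let field (G : set (K * K * K)) := [set x | exists z, G ((x, x), z)].

(* Graphs of injections of D x D into D; D is recovered as [field G]. *)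
Let pairing_graph (G : set (K * K * K)) :=
  [/\ forall x y z, G ((x, y), z) -> [/\ field G x, field G y & field G z],
      forall x y, field G x -> field G y -> exists z, G ((x, y), z) &
      forall p q, G p -> G q -> (p.1 = q.1 <-> p.2 = q.2)].

Lemma pairing_graph_bigcup (F : set (set (K * K * K))) :
  F `<=` pairing_graph -> total_on F subset ->
  pairing_graph (\bigcup_(G in F) G).
Proof.
move=> FP totF; split.
- move=> x y z [G FG].
  by case: (FP _ FG) => H _ _ /H[[a Ga] [b Gb] [c Gc]]; split;
    [exists a|exists b|exists c]; exists G.
- move=> x y [a [G FG Ga]] [b [H FH Hb]].
  have [GH|HG] := totF _ _ FG FH.
    have [_ /(_ x y) HH _] := FP _ FH.
    by have [||z Hz] := HH; [exists a; exact: GH|exists b|exists z; exists H].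
  have [_ /(_ x y) GG _] := FP _ FG.
  by have [||z Gz] := GG; [exists a|exists b; exact: HG|exists z; exists G].
- move=> p q [G FG Gp] [H FH Hq].
  have [GH|HG] := totF _ _ FG FH.
    by have [_ _] := FP _ FH; apply=> //; exact: GH.
  by have [_ _] := FP _ FG; apply=> //; exact: HG.
Qed.

Lemma infinite_pairing : infinite_set [set: K] ->
  exists f : K -> K -> K, forall x y x' y', f x y = f x' y' -> x = x' /\ y = y'.
Proof.
move=> /infinite_nat_injection[i i_inj].
pose G0 := [set p | exists a b : nat, p = ((i a, i b), i (pickle (a, b)))].
have fieldG0 x : field G0 x <-> exists a, x = i a.
  split=> [[z [a [b [-> _]]]]|[a ->]]; first by exists a.
  by exists (i (pickle (a, a))); exists a, a.
have PG0 : pairing_graph G0.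
  split.
  - by move=> x y z [a [b [-> -> ->]]]; split; apply/fieldG0; eexists.
  - move=> x y /fieldG0[a ->] /fieldG0[b ->].
    by exists (i (pickle (a, b))), a, b.
  - move=> _ _ [a [b ->]] [c [d ->]] /=.
    split=> [[/i_inj -> /i_inj ->]//|/i_inj/(pcan_inj pickleK)[-> ->]//].
have [|G [G0G [GD Gtot Ginj] maxG]] := Zorn_bigcup_above PG0.
  by move=> F _; exact: pairing_graph_bigcup.
pose D := field G.
have DG0 a : D (i a).
  have [z /G0G Gz] := (fieldG0 (i a)).2 (ex_intro _ a erefl).
  by exists z.
have /choice[f0 f0P] : forall p : K * K, exists z, D p.1 -> D p.2 -> G (p, z).
  move=> [x y]; have [Dx|] := pselect (D x); last by exists x.
  have [Dy|] := pselect (D y); last by exists x.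
  by have [z Gz] := Gtot _ _ Dx Dy; exists z.
pose f x y := f0 (x, y).
have fG x y : D x -> D y -> G ((x, y), f x y) by move=> Dx Dy; exact: f0P.
have fD x y : D x -> D y -> D (f x y).
  by move=> Dx Dy; have [] := GD _ _ _ (fG _ _ Dx Dy).
have fI x y x' y' : D x -> D y -> D x' -> D y' ->
    f x y = f x' y' -> x = x' /\ y = y'.
  move=> Dx Dy Dx' Dy' E.
  by have /= [_ /(_ E) [-> ->]] := Ginj _ _ (fG _ _ Dx Dy) (fG _ _ Dx' Dy').
have t01 : i 0 <> i 1 by move=> /i_inj.
have [[h [hD hI]]|[h [hD hI]]] := injects_total (~` D) D (i 0) (i 0).
  pose phi x := if pselect (D x) then f (i 0) x else f (i 1) (h x).
  have phiD x : D (phi x).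
    by rewrite /phi; case: pselect => Dx; apply: fD => //; exact: hD.
  have phiI : injective phi.
    move=> x y; rewrite /phi; case: pselect => Dx; case: pselect => Dy E.
    - by have [] := fI _ _ _ _ _ _ _ _ E.
    - by have [] // := fI _ _ _ _ _ _ _ _ E; apply: hD.
    - by have [] // := fI _ _ _ _ _ _ _ _ E; [apply: hD|move=> /esym].
    - have [] // := fI _ _ _ _ _ _ _ _ E; [exact: hD|exact: hD|move=> _].
      exact: hI.
  exists (fun x y => f (phi x) (phi y)) => x y x' y' E.
  by have [/phiI -> /phiI ->] :=
    fI _ _ _ _ (phiD _) (phiD _) (phiD _) (phiD _) E.
(* D and a disjoint copy h(D) have a union whose square embeds in h(D), so the
   pairing extends to it, against maximality. *)
exfalso.
pose E := [set h x | x in D].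
have ED x : E x -> ~ D x by move=> [y /hD + <-].
have /choice[r rP] : forall x, exists y, E x -> D y /\ h y = x.
  by move=> x; have [[y Dy hy]|] := pselect (E x); [exists y|exists x].
pose D' := D `|` E.
pose phi x := if pselect (D x) then f (i 0) x else f (i 1) (r x).
have phiD x : D' x -> D (phi x).
  rewrite /phi; case: pselect => Dx; first by move=> _; apply: fD.
  by case=> // /rP[Dr _]; apply: fD.
have phiI x y : D' x -> D' y -> phi x = phi y -> x = y.
  rewrite /phi; case: pselect => Dx; case: pselect => Dy.
  - by move=> _ _ /fI[].
  - by move=> _ [//|/rP[Dr _]] /fI[].
  - by move=> [//|/rP[Dr _]] _ /fI[] // /esym.
  - move=> [//|/rP[Drx hx]] [//|/rP[Dry hy]] /fI[] // _ Er.
    by rewrite -hx -hy Er.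
pose g x y := h (f (phi x) (phi y)).
have gE x y : D' x -> D' y -> E (g x y).
  by move=> /phiD Dx /phiD Dy; exists (f (phi x) (phi y)) => //; exact: fD.
pose N := [set p | [/\ D' p.1.1, D' p.1.2, ~ (D p.1.1 /\ D p.1.2) &
  p.2 = g p.1.1 p.1.2]].
pose G' := G `|` N.
have fieldG' x : field G' x <-> D' x.
  split=> [[z [Gz|[]//]]|D'x]; first by left; exists z.
  have [[z Gz]|nDx] := pselect (D x); first by exists z; left.
  by exists (g x x); right; split=> // -[].
apply: (maxG G').
  pose e := h (i 0).
  split=> [p|/(_ ((e, e), g e e)) GG]; first by left.
  have Eh : E e by exists (i 0).
  have [|Dh _ _] := GD _ _ _ (GG _); last exact: ED Dh.
  by right; split=> //; [right|right|move=> -[/(ED _ Eh)]].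
split.
- move=> x y z [/GD[Dx Dy Dz]|[]/= Dx Dy _ ->]; split; apply/fieldG' => //;
    try by left.
  by right; exact: gE.
- move=> x y /fieldG' Dx /fieldG' Dy.
  have [[Dx' Dy']|nD] := pselect (D x /\ D y).
    by exists (f x y); left; exact: fG.
  by exists (g x y); right.
- have noclash p q : G p -> N q -> p.1 <> q.1 /\ p.2 <> q.2.
    case: p q => [[x y] z] [[x' y'] z'] /GD[Dx Dy Dz] []/= Dx' Dy' nD ->.
    split=> [[Ex Ey]|Ez]; first by apply: nD; rewrite -Ex -Ey.
    by apply: (ED z) => //; rewrite Ez; exact: gE.
  move=> p q [Gp|Np] [Gq|Nq].
  + exact: Ginj.
  + by have [? ?] := noclash _ _ Gp Nq; split.
  + by have [/nesym ? /nesym ?] := noclash _ _ Gq Np; split.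
  + case: p q Np Nq => [[x y] z] [[x' y'] z'] []/= Dx Dy _ -> []/= Dx' Dy' _ ->.
    have [? ? ? ?] := And4 (phiD _ Dx) (phiD _ Dy) (phiD _ Dx') (phiD _ Dy').
    split=> [[-> ->]//|/hI Ef].
    have /fI[] // : f (phi x) (phi y) = f (phi x') (phi y').
      by apply: Ef; exact: fD.
    by move=> /phiI -> // /phiI ->.
Qed.

End Squares.

Lemma formula_injection (K : Type) : infinite_set [set: K] ->
  exists e : formula K -> K, injective e.
Proof.
move=> Kinf; have [f fI] := infinite_pairing Kinf.
have [i i_inj] := infinite_nat_injection Kinf.
pose fix e (g : formula K) := match g with
  | Var p => f (i 0) p
  | And g h => f (i 1) (f (e g) (e h))
  | Neg g => f (i 2) (e g)
  | Dia g => f (i 3) (e g)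
  end.
exists e; elim=> [p|g IHg h IHh|g IHg|g IHg] [q|g' h'|g'|g'] /= /fI[/i_inj//].
- by move=> _ ->.
- by move=> _ /fI[/IHg -> /IHh ->].
- by move=> _ /IHg ->.
- by move=> _ /IHg ->.
Qed.

Ltac taut :=
  let e := fresh "e" in let eA := fresh "eA" in let eN := fresh "eN" in
  move=> e eA eN; rewrite /Imp /Or ?(eN, eA);
  repeat match goal with |- context [e ?g] => case: (e g) => //= end.

Section Theories.
Variable V : Type.
Implicit Types (T w : set (formula V)) (f g h : formula V).

Definition theory T :=
  tautology `<=` T /\ (forall f g, T (Imp f g) -> T f -> T g).

Definition ultra w := (forall f g, w (And f g) <-> w f /\ w g) /\
  (forall f, w (Neg f) <-> ~ w f).

Lemma ultra_Or w : ultra w -> forall f g, w (Or f g) <-> w f \/ w g.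
Proof.
move=> [wA wN] f g; rewrite /Or wN wA !wN; split=> [/not_andP[]/contrapT|[]].
- by left.
- by right.
- by move=> wf [].
- by move=> wg [].
Qed.

Lemma ultra_Imp w : ultra w -> forall f g, w (Imp f g) <-> (w f -> w g).
Proof.
move=> uw f g; rewrite /Imp ultra_Or// uw.2; split=> [[]//|fg].
by have [/fg|] := pselect (w f); [right|left].
Qed.

Lemma ultra_sub_eq w w' : ultra w -> ultra w' -> w `<=` w' -> w = w'.
Proof.
move=> [_ wN] [_ wN'] ww'; apply/seteqP; split=> // f w'f.
by apply: contrapT => /wN/ww'/wN'.
Qed.

Lemma lindenbaum T f : theory T -> ~ T f ->
  exists w, [/\ T `<=` w, ultra w & ~ w f].
Proof.
move=> thT nTf; pose P := [set M | theory M /\ ~ M f].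
have [||M [TM [[Mtaut Mmp] nMf] maxM]] := @Zorn_bigcup_above _ P T.
- by split.
- move=> F [M0 FM0] FP totF; split; first split.
  + by move=> g tg; exists M0 => //; apply: (FP _ FM0).1.1.
  + move=> g h [M FM Mgh] [N FN Ng]; have [MN|NM] := totF _ _ FM FN.
      by exists N => //; apply: (FP _ FN).1.2 Ng; exact: MN.
    by exists M => //; apply: (FP _ FM).1.2 Mgh _; exact: NM.
  + by move=> [M FM Mf]; exact: (FP _ FM).2 Mf.
exists M; split=> //.
have Mtm g h : tautology (Imp g h) -> M g -> M h by move=> /Mtaut; exact: Mmp.
have ext g : ~ M g -> M (Imp g f).
  move=> nMg; apply: contrapT => nMgf.
  apply: (maxM [set h | M (Imp g h)]).
    split=> [h Mh|MM]; first by apply: Mtm Mh; taut.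
    by apply/nMg/MM/Mtaut; taut.
  split=> //; split=> [h th|h k /= Mghk Mgh].
    by apply/(Mtm _ _ _ (Mtaut _ th)); taut.
  by apply: Mmp Mgh; apply: Mtm Mghk; taut.
have MN g : M (Neg g) <-> ~ M g.
  split=> [MNg Mg|/ext Mgf]; first by apply/nMf/Mmp/Mg/Mtm/MNg; taut.
  apply: contrapT => /ext MNgf; apply/nMf/Mmp/MNgf.
  by apply: Mtm Mgf; taut.
split=> // g h; split=> [Mgh|[Mg Mh]].
  by split; apply: Mtm Mgh; taut.
by apply: Mmp Mh; apply: Mtm Mg; taut.
Qed.

Definition S5_theory T := theory T /\
  [/\ forall f g, T (Imp f g) -> T (Imp (Dia f) (Dia g)),
      forall f g, T (Imp (Dia (Or f g)) (Or (Dia f) (Dia g))),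
      forall f, T (Imp f (Dia f)) /\ T (Imp (Dia (Dia f)) (Dia f)),
      forall f, T (Neg (Dia (And f (Neg f)))) &
      forall f, T (Imp (Dia f) (Box (Dia f)))].

Definition S5_cluster T w0 w :=
  [/\ T `<=` w, ultra w & forall f, w (Dia f) <-> w0 (Dia f)].

Lemma cluster_refl T w : T `<=` w -> ultra w -> S5_cluster T w w.
Proof. by []. Qed.

Lemma cluster_Dia T w0 w f :
  S5_theory T -> S5_cluster T w0 w -> w f -> w0 (Dia f).
Proof.
move=> [_ [_ _ Trefl _ _]] [Tw uw <-].
by have /Tw/(ultra_Imp uw) := (Trefl f).1.
Qed.

Lemma cluster_witness T w0 f : S5_theory T -> T `<=` w0 -> ultra w0 ->
  w0 (Dia f) -> exists2 w, S5_cluster T w0 w & w f.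
Proof.
move=> [[Ttaut Tmp] [Tmono Tadd Ttr Tbot Teucl]] Tw0 uw0 w0f.
have Tmt g h : tautology (Imp g h) -> T g -> T h by move=> /Ttaut; exact: Tmp.
have mono g h : T (Imp g h) -> w0 (Dia g) -> w0 (Dia h).
  by move=> /Tmono/Tw0/(ultra_Imp uw0).
pose S := [set h | ~ w0 (Dia (And f (Neg h)))].
have TS : T `<=` S.
  move=> h Th w0h; have /uw0.2 := Tw0 _ (Tbot h); apply.
  by apply: mono w0h; apply: Tmt Th; taut.
have thS : theory S.
  split=> [h /Ttaut/TS//|h k nhk nh].
  move=> w0k.
  have /Tw0/(ultra_Imp uw0) := Tadd (And f (Neg (Imp h k))) (And f (Neg h)).
  suff w0hk : w0 (Dia (Or (And f (Neg (Imp h k))) (And f (Neg h)))).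
    by move=> /(_ w0hk)/(ultra_Or uw0)[].
  by apply: mono w0k; apply: Ttaut; taut.
have nSf : ~ S (Neg f).
  by apply; apply: mono w0f; apply: Ttaut; taut.
have [w [Sw uw nwf]] := lindenbaum thS nSf.
have Tw : T `<=` w by move=> h /TS/Sw.
exists w; last by apply: contrapT => /uw.2.
split=> // h; split.
  apply: contraPP => nh; apply/uw.2/Sw => w0h; apply: nh.
  have /Tw0/(ultra_Imp uw0) := (Ttr h).2; apply.
  by apply: mono w0h; apply: Ttaut; taut.
move=> w0h; apply: Sw => w0Nh.
have /Tw0/(ultra_Imp uw0)/(_ w0h) := Teucl h.
by rewrite /Box; move=> /uw0.2; apply; apply: mono w0Nh; apply: Ttaut; taut.
Qed.

Lemma derivable_S5_theory (p q : V) (Ax G : set (formula V)) :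
  p <> q -> S5_axiom `<=` Ax -> S5_theory (derivable (theorems Ax) G).
Proof.
move=> pq S5Ax.
have inst s f : S5_axiom f -> derivable (theorems Ax) G (subst s f).
  by move=> /S5Ax Af; apply/der_thm/thm_subst/thm_ax.
split; first split.
- by move=> f tf; apply/der_thm/thm_ax/S5Ax/S5_taut.
- exact: der_mp.
split.
- exact: der_mono.
- move=> f g; pose s r := if pselect (r = p) then f else g.
  have sp : s p = f by rewrite /s; case: pselect.
  have sq : s q = g by rewrite /s; case: pselect => // qp; case: pq.
  by have := inst s _ (S5_add p q); rewrite /= sp sq.
- move=> f; split; first exact: (inst (fun=> f) _ (S5_refl p)).
  exact: (inst (fun=> f) _ (S5_trans p)).
- by move=> f; exact: (inst (fun=> f) _ (S5_bot p)).
- by move=> f; exact: (inst (fun=> f) _ (S5_eucl p)).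
Qed.

End Theories.

Lemma cluster_enum_infinite (K : Type) (T w0 : set (formula K)) :
  infinite_set [set: K] -> S5_theory T -> T `<=` w0 -> ultra w0 ->
  exists w : K -> set (formula K), (forall k, S5_cluster T w0 (w k)) /\
    (forall f, w0 (Dia f) -> exists k, w k f).
Proof.
move=> Kinf ST Tw0 uw0; have [e e_inj] := formula_injection Kinf.
have /choice[w wP] : forall k, exists w, S5_cluster T w0 w /\
    forall f, e f = k -> w0 (Dia f) -> w f.
  move=> k; have [[f [<- w0f]]|nf] := pselect (exists f, e f = k /\ w0 (Dia f)).
    have [w Cw wf] := cluster_witness ST Tw0 uw0 w0f.
    by exists w; split=> // g /e_inj ->.
  exists w0; split; first exact: cluster_refl.
  by move=> f ef w0f; case: nf; exists f.
exists w; split=> [k|f w0f]; first exact: (wP k).1.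
by exists (e f); apply: (wP _).2.
Qed.

Lemma subst_Var (V : Type) (f : formula V) : subst Var f = f.
Proof. by elim: f => [|f /= -> g ->|f /= ->|f /= ->]. Qed.

Lemma ultra_subst_bigAnd (w : set (formula nat)) s (r : seq nat)
    (F : nat -> formula nat) : ultra w ->
  w (subst s (\big[And/Top 0]_(i <- r) F i)) <->
  (forall i, i \in r -> w (subst s (F i))).
Proof.
move=> uw; elim: r => [|i r IHr].
  by rewrite big_nil /= uw.2 uw.1 uw.2; split=> // _ [].
rewrite big_cons /= uw.1 IHr; split=> [[wi wr] j|wr].
  by rewrite inE => /orP[/eqP ->//|]; exact: wr.
by split=> [|j jr]; apply: wr; rewrite inE ?eqxx ?jr ?orbT.
Qed.

Lemma ultra_subst_bigOr (w : set (formula nat)) s (r : seq nat)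
    (F : nat -> formula nat) : ultra w ->
  w (subst s (\big[Or/Bot 0]_(i <- r) F i)) <->
  (exists2 i, i \in r & w (subst s (F i))).
Proof.
move=> uw; elim: r => [|i r IHr].
  by rewrite big_nil /= uw.1 uw.2; split=> [[]|[]].
rewrite big_cons; have := ultra_Or uw (subst s (F i)).
rewrite {1}/Or /= => ->; rewrite IHr; split=> [[wi|[j jr wj]]|[j]].
- by exists i => //; rewrite inE eqxx.
- by exists j => //; rewrite inE jr orbT.
- by rewrite inE => /orP[/eqP ->|jr wj]; [left|right; exists j].
Qed.

Lemma cluster_bounded n (T w0 : set (formula nat))
    (w : nat -> set (formula nat)) :
  S5_theory T -> T `<=` w0 -> ultra w0 ->
  (forall s, T (subst s (bounded_axiom n))) ->
  (forall i, S5_cluster T w0 (w i)) ->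
  exists i j, [/\ 1 <= i, i < j, j < n.+2 & w i = w j]%N.
Proof.
move=> ST Tw0 uw0 Tbd Cw; apply: contrapT => winj.
have sep i j : exists d, (1 <= i < n.+2)%N -> (1 <= j < n.+2)%N -> i <> j ->
    w i d /\ ~ w j d.
  have [ij|ij] := pselect (w i = w j); last first.
    have [_ uwi _] := Cw i; have [_ uwj _] := Cw j.
    have /existsNP[d /not_implyP[wd nwd]] : ~ (w i `<=` w j).
      by move=> /(ultra_sub_eq uwi uwj).
    by exists d.
  exists (Var 0) => /andP[i1 i2] /andP[j1 j2] /eqP; case: ltngtP => // lij _;
    exfalso.
    by apply: winj; exists i, j.
  by apply: winj; exists j, i.
have /choice[d dP] : forall ij : nat * nat, exists d, (1 <= ij.1 < n.+2)%N ->
    (1 <= ij.2 < n.+2)%N -> ij.1 <> ij.2 -> w ij.1 d /\ ~ w ij.2 d.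
  by move=> [i j]; exact: sep.
(* Among the [w j], the formula [s i] holds at [w i] only. *)
pose s i := \big[And/Top 0]_(j <- index_iota 1 n.+2)
  if j == i then Top 0 else And (d (i, j)) (Neg (d (j, i))).
have sP i v : ultra v -> v (s i) <->
    forall j, j \in index_iota 1 n.+2 -> j <> i ->
      v (d (i, j)) /\ ~ v (d (j, i)).
  move=> uv; rewrite -[s i]subst_Var ultra_subst_bigAnd //; split=> H j jr.
    by move=> /eqP/negPf ji; have := H j jr; rewrite ji subst_Var uv.1 uv.2.
  rewrite subst_Var; case: eqP => [_|ji]; last by rewrite uv.1 uv.2; exact: H.
  by rewrite uv.2 uv.1 uv.2 => -[].
have := Tw0 _ (Tbd s); rewrite /bounded_axiom [subst _ _]/= -/(Imp _ _).
move=> /(ultra_Imp uw0) bd.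
have /bd : w0 (subst s (\big[And/Top 0]_(1 <= i < n.+2) Dia (Var i))).
  apply/ultra_subst_bigAnd => // i ir /=.
  have [Twi uwi _] := Cw i; apply: (cluster_Dia ST (Cw i)).
  move: ir; rewrite mem_index_iota => ir.
  apply/sP => // j; rewrite mem_index_iota => jr ji; split.
    by have [] := dP (i, j) ir jr (nesym ji).
  by have [] := dP (j, i) jr ir ji.
move=> /(ultra_subst_bigOr _ _ _ uw0)[i].
rewrite mem_index_iota => /andP[i1 i2].
move=> /(ultra_subst_bigOr _ _ _ uw0)[j].
rewrite mem_index_iota => /andP[ij j2] /=.
move=> /(cluster_witness ST Tw0 uw0)[v [_ uv _]].
rewrite uv.1 !sP // => -[/(_ j) vi /(_ i) vj].
have [||_ nd] := vj.
- by rewrite mem_index_iota i1 i2.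
- by move=> E; move: ij; rewrite E ltnn.
have [||//] := vi.
- by rewrite mem_index_iota j2 (leq_trans i1 (ltnW ij)).
- by move=> E; move: ij; rewrite E ltnn.
Qed.

Lemma cluster_enum_bounded (K : Type) n (T w0 : set (formula nat)) :
  [set: K] #= `I_n -> [set: K] !=set0 ->
  S5_theory T -> T `<=` w0 -> ultra w0 ->
  (forall s, T (subst s (bounded_axiom n))) ->
  exists w : K -> set (formula nat), (forall k, S5_cluster T w0 (w k)) /\
    (forall f, w0 (Dia f) -> exists k, w k f).
Proof.
move=> /card_esym Kn [k0 _] ST Tw0 uw0 Tbd; pose C := S5_cluster T w0.
have Cw0 : C w0 by exact: cluster_refl.
suff [w [wC Cw]] : exists w : K -> set (formula nat), (forall k, C (w k)) /\
    (forall v, C v -> exists k, w k = v).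
  exists w; split=> // f /(cluster_witness ST Tw0 uw0)[v Cv vf].
  by have [k wk] := Cw _ Cv; exists k; rewrite wk.
have [[f [_ fI]]|[f [fC fI]]] := injects_total C [set: K] w0 k0.
  have /choice[w wP] : forall k, exists v,
      C v /\ forall u, C u -> f u = k -> u = v.
    move=> k; have [[v [Cv <-]]|nv] := pselect (exists v, C v /\ f v = k).
      by exists v; split=> // u Cu /fI ->.
    by exists w0; split=> // u Cu fu; case: nv; exists u.
  exists w; split=> [k|v Cv]; first exact: (wP k).1.
  by exists (f v); apply/esym/(wP (f v)).2.
exists f; split=> [k|v Cv]; first exact: fC.
apply: contrapT => nf.
have /card_esym/card_set_bijP[b [bI b_inj b_surj]] := Kn.
have /choice[c cP] : forall i, exists k, (i < n)%N -> b k = i.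
  by move=> i; case: (ltnP i n) => [/b_surj[k _ <-]|_]; [exists k|exists k0].
pose w i := if (i < n.+1)%N then f (c i.-1) else v.
have [|i [j [i1 ij j2]]] := @cluster_bounded n T w0 w ST Tw0 uw0 Tbd.
  by move=> i; rewrite /w; case: ifP => _ //; exact: fC.
have {}i2 : (i < n.+1)%N by rewrite (leq_trans ij).
rewrite /w i2; case: ifP => [j3|_ fv]; last by apply: nf; eexists; exact: fv.
move: i1 ij i2 j3; case: i j {j2} => [//|i] [//|j] _ ij; rewrite !ltnS => i2 j3.
move=> E; have /(congr1 b) := fI _ _ I I E; rewrite !cP // => {}E.
by move: E ij => /= ->; rewrite ltnn.
Qed.

Section Category.
Context {X : topologicalType}.
Implicit Types A B U W : set X.

Lemma nowhere_dense_frontier F : closed F -> nowhere_dense (F `\` F^° : set X).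
Proof.
move=> cF; apply/nowhere_denseP => U oU [x Ux].
have [UF|/existsNP[y /not_implyP[Uy nFy]]] := pselect (U `<=` F).
  exists U; split=> //; first by exists x.
  apply/seteqP; split=> // z [Uz [_]]; apply.
  by rewrite /interior nbhsE; exists U.
exists (U `&` ~` F); split.
- by apply: openI => //; exact: closed_openC.
- by exists y.
- by move=> z [].
- by apply/seteqP; split=> // z [[_ nFz] []].
Qed.

Lemma open_meager_part A : open (meager_part A).
Proof. by apply: bigcup_open => U []. Qed.

Lemma meager_bigcup_seq (I : eqType) (r : seq I) (F : I -> set X) :
  (forall i, i \in r -> meager (F i)) ->
  meager [set x | exists2 i, i \in r & F i x].
Proof.
elim: r => [_|i r IHr Hr]; first by apply: meagerS meager0 => x [].
apply: (@meagerS _ _ (F i `|` [set x | exists2 i, i \in r & F i x])).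
  by move=> x [j]; rewrite inE => /orP[/eqP ->|jr Fx]; [left|right; exists j].
apply: meagerU; first by apply: Hr; rewrite inE eqxx.
by apply: IHr => j jr; apply: Hr; rewrite inE jr orbT.
Qed.

Lemma open_bigcap_seq (I : eqType) (r : seq I) (F : I -> set X) :
  (forall i, i \in r -> open (F i)) ->
  open [set x | forall i, i \in r -> F i x].
Proof.
elim: r => [_|i r IHr Hr].
  by rewrite (_ : [set _ | _] = setT); [exact: openT|apply/seteqP; split].
rewrite (_ : [set _ | _] = F i `&` [set x | forall i, i \in r -> F i x]).
  apply: openI; first by apply: Hr; rewrite inE eqxx.
  by apply: IHr => j jr; apply: Hr; rewrite inE jr orbT.
apply/seteqP; split=> x /= => [Fx|[Fi Fr] j].
  by split=> [|j jr]; apply: Fx; rewrite inE ?eqxx ?jr ?orbT.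
by rewrite inE => /orP[/eqP ->|/Fr].
Qed.

Lemma meager_image_val W (S : set (set_type W)) : open W -> meager S ->
  meager (val @` S).
Proof.
move=> oW [F ndF ->].
exists (fun n => val @` F n); last by rewrite image_bigcup.
move=> n; apply/nowhere_denseP => U oU U0.
have [[x [Ux Wx]]|UW0] := pselect (exists x, U x /\ W x); last first.
  exists U; split=> //; apply/seteqP; split=> // x [Ux [[y Wy] _ /= yx]].
  by apply: UW0; exists x; split=> //; rewrite -yx; exact: set_mem.
have oUW : open (val @^-1` U : set (set_type W)) by exists U.
have UW0 : (val @^-1` U : set (set_type W)) !=set0.
  by exists (exist _ x (mem_set Wx)).
have /nowhere_denseP/(_ _ oUW UW0)[_ [[O oO <-] [y Oy] OU OF]] := ndF n.
exists (O `&` W); split.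
- exact: openI.
- by exists (val y); split=> //; apply: set_mem; exact: (valP y).
- by move=> z [Oz Wz]; apply: (OU (exist _ z (mem_set Wz))).
- apply/seteqP; split=> // y0 [[+ _] [z Fz zy]]; rewrite -zy => Oz.
  have : ((set_val @^-1` O) `&` F n) z by [].
  by rewrite OF.
Qed.

Lemma clop_class A : clop (baire_class A) = baire_class (~` meager_part A).
Proof.
have [clA lbA] := baire_closureP (baire_class A).
have [mpA lbmpA] := is_baire_closureE A.
by apply/eqP; rewrite eq_le; apply/andP; split; [exact: lbA|exact: lbmpA].
Qed.

Lemma baire_class_top A : baire_class A = \top%O <-> meager (~` A).
Proof.
rewrite -[\top%O]/(baire_class [set: X]) baire_classP.
by rewrite /setY setDT set0U setTD.
Qed.

Section Representatives.
Context {V : Type} (v : V -> baire_algebra X).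

Fixpoint rep (f : formula V) : set X :=
  match f with
  | Var p => repr (v p)
  | And g h => rep g `&` rep h
  | Neg g => ~` rep g
  | Dia g => ~` meager_part (rep g)
  end.

Lemma rep_class f : baire_class (rep f) = eval v f.
Proof.
elim: f => [p|g IHg h IHh|g IHg|g IHg] /=.
- by rewrite /baire_class reprK.
- by rewrite -IHg -IHh [RHS]baire_meetE.
- by rewrite -IHg [RHS]baire_complE.
- by rewrite -IHg clop_class.
Qed.

Lemma eval_top f : eval v f = \top%O <-> meager (~` rep f).
Proof. by rewrite -rep_class baire_class_top. Qed.

Lemma ultra_rep x : ultra (fun f => rep f x).
Proof. by []. Qed.

End Representatives.
End Category.

Section Soundness.
Context {V : Type}.

Section ClosureAlgebra.
Context {d : Order.disp_t} {B : closureAlgType d}.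
Implicit Type v : V -> B.

Lemma eval_subst v s f :
  eval v (subst s f) = eval (fun p => eval v (s p)) f.
Proof. by elim: f => [|f /= -> g ->|f /= ->|f /= ->]. Qed.

Lemma eval_Or v f g : eval v (Or f g) = (eval v f `|` eval v g)%O.
Proof. by rewrite /= complI !complK. Qed.

Lemma eval_Imp v f g :
  eval v (Imp f g) = \top%O <-> (eval v f <= eval v g)%O.
Proof.
rewrite /Imp eval_Or /=; split=> [E|fg].
  by rewrite -[leLHS]meetx1 -E meetUr meetxC join0x leIr.
by apply/eqP; rewrite eq_le lex1 /= -(joinCx (eval v f)) leU2.
Qed.

Lemma le_clop2 (a b : B) : (a <= b)%O -> (clop a <= clop b)%O.
Proof. by move=> /join_idPr <-; rewrite clopU leUl. Qed.

Lemma theorems_sound (Ax : set (formula V)) :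
  (forall f, Ax f -> valid B f) -> sound B (theorems Ax).
Proof.
move=> AxB f.
elim=> [{}f /AxB//|s {}f _ IH v|{}f g _ IHfg _ IHf v|{}f g _ IH v].
- by rewrite eval_subst; exact: IH.
- by apply/eqP; rewrite eq_le lex1 -(IHf v); exact/eval_Imp.
- by apply/eval_Imp/le_clop2/eval_Imp.
Qed.

End ClosureAlgebra.

Lemma S5_axiom_valid (X : topologicalType) (f : formula V) :
  S5_axiom f -> valid (baire_algebra X) f.
Proof.
move=> + v; case=> {f} [f tf|p q|p|p|p|p].
- apply/eval_top; apply: meagerS meager0 => x; apply.
  apply/asboolP; apply: (tf (fun g => `[< rep v g x >])) => [g h|g] /=.
    exact: asbool_and.
  exact: asbool_neg.
- by apply/eval_Imp; rewrite eval_Or [leLHS]/= -clopU complI !complK.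
- by apply/eval_Imp/le_clop.
- by apply/eval_Imp; rewrite /= clop_idem.
- by rewrite /= meetxC clop0 compl0.
- apply/eval_top; set F := ~` meager_part (repr (v p)).
  have cF : closed F by apply/open_closedC/open_meager_part.
  apply: meagerS (nowhere_dense_meager (nowhere_dense_frontier cF)) => x.
  move=> nx; split.
    apply: contrapT => nFx; apply: nx.
    by apply/(ultra_Imp (ultra_rep v x)).
  move=> Fx; apply: nx; apply/(ultra_Imp (ultra_rep v x)) => _ /=; apply.
  exists F^° => //; split; first exact: open_interior.
  rewrite -/F; apply: meagerS meager0 => y [nFy] /interior_subset.
  exact: nFy.
Qed.

End Soundness.

Lemma bounded_axiom_valid (X : topologicalType) (K : Type) n :
  [set: K] #= `I_n ->
  (forall U : set X, open U -> U !=set0 ->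
     ~ baire_resolvable (option K) (set_type U)) ->
  valid (baire_algebra X) (bounded_axiom n).
Proof.
move=> /card_set_bijP[b [bI b_inj _]] nres v; apply/eval_top.
pose A i := repr (v i); pose r := index_iota 1 n.+2.
pose F := \bigcap_(i in [set` r]) ~` meager_part (A i).
pose O := [set x | forall i, i \in r -> [set x | forall j,
  j \in index_iota i.+1 n.+2 -> meager_part (A i `&` A j) x] x].
have cF : closed F.
  by apply: closed_bigI => i _; apply/open_closedC/open_meager_part.
have oO : open O.
  apply: open_bigcap_seq => i _; apply: open_bigcap_seq => j _.
  exact: open_meager_part.
have badFO : ~` rep v (bounded_axiom n) `<=` F `&` O.
  move=> x /(ultra_Imp (ultra_rep v x)) /not_implyP[/= xF xO]; split.
    move=> i ir; rewrite -[X in rep v X]subst_Var in xF.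
    exact: (ultra_subst_bigAnd _ _ _ (ultra_rep v x)).1 xF i ir.
  move=> i ir j jr; apply: contrapT => nx; apply: xO.
  rewrite -[X in rep v X]subst_Var.
  apply/(ultra_subst_bigOr _ _ _ (ultra_rep v x)).
  exists i => //; apply/(ultra_subst_bigOr _ _ _ (ultra_rep v x)).
  by exists j.
pose W := F^° `&` O.
apply: contrapT => nmbad.
have oW : open W by apply: openI => //; exact: open_interior.
have W0 : W !=set0.
  apply: contrapT => W0; apply: nmbad.
  apply: meagerS (nowhere_dense_meager (nowhere_dense_frontier cF)) => x.
  by move=> /badFO[Fx Ox]; split=> // Fix; apply: W0; exists x; split.
apply: (nres W) => //.
have mAA i j : i \in r -> j \in r -> i != j -> meager (A i `&` A j `&` W).
  move=> ir jr; wlog : i j ir jr / (i < j)%N => [H|ij _].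
    case: ltngtP => // ij _; first by apply: H => //; rewrite ltn_eqF.
    by rewrite (setIC (A i)); apply: H => //; rewrite ltn_eqF.
  apply: meagerS (meager_meager_part (A i `&` A j)) => x [Ax [_ Ox]].
  split=> //; apply: (Ox i ir j); move: jr.
  by rewrite !mem_index_iota ij => /andP[].
pose B i := A i `&` [set x | forall j, j \in r -> A j x -> j = i].
have nmB i U :
    i \in r -> open U -> U !=set0 -> U `<=` W -> ~ meager (B i `&` U).
  move=> ir oU [x Ux] UW mB.
  have [/interior_subset/(_ i ir) Fx _] := UW _ Ux.
  apply: Fx; exists U => //; split=> //.
  pose M := [set x | exists2 j, j \in r & (j != i) /\ (A i `&` A j `&` W) x].
  apply: (@meagerS _ _ (M `|` (B i `&` U))).
    move=> y [Ay Uy]; have [My|nMy] := pselect (M y); first by left.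
    right; split=> //; split=> // j jr Ajy; apply: contrapT => /eqP ji.
    by apply: nMy; exists j => //; split=> //; split=> //; exact: UW.
  apply: meagerU => //; apply: meager_bigcup_seq => j jr.
  have [ji|ij] := eqVneq j i; first by apply: meagerS meager0 => y [].
  by apply: meagerS (mAA i j ir jr _) => [y []//|]; rewrite eq_sym.
pose idx (o : option K) := if o is Some k then (b k).+1 else n.+1.
have idx_r o : idx o \in r.
  by rewrite mem_index_iota; case: o => [k|] //=; rewrite ltnS; apply/ltnW/bI.
have idx_inj o o' : idx o = idx o' -> o = o'.
  case: o o' => [k|] [l|] //= [E].
  - by rewrite (b_inj k l) ?in_setT.
  - by have := bI k I; rewrite /= E ltnn.
  - by have := bI l I; rewrite /= -E ltnn.
have /choice[c cP] : forall x, exists o, forall o', B (idx o') x -> o = o'.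
  move=> x.
  have [[o [Ao Bo]]|nB] := pselect (exists o, B (idx o) x); last first.
    by exists None => o' Bo'; case: nB; exists o'.
  by exists o => o' [Ao' Bo']; apply/idx_inj/Bo'.
have nmP o (U : set (set_type W)) : open U -> U !=set0 ->
    ~ meager ([set x : set_type W | c (val x) = o] `&` U).
  move=> [Q oQ <-] [x Qx] mU.
  apply: (nmB (idx o) (Q `&` W)) => //.
  - exact: openI.
  - by exists (val x); split=> //; apply: set_mem; exact: (valP x).
  apply: meagerS (meager_image_val oW mU) => y [By [Qy Wy]].
  by exists (exist _ y (mem_set Wy)) => //; split=> //=; exact: cP.
exists (fun o => [set x : set_type W | c (val x) = o]); last exact: nmP.
split.
- by apply/seteqP; split=> // x _; exists (c (val x)).
- by move=> o o' _ _ [x [/= -> ->]].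
- move=> o _; apply: contrapT => P0; have [x Wx] := W0.
  apply: (nmP o setT); first exact: openT.
    by exists (exist _ x (mem_set Wx)).
  by apply: meagerS meager0 => y [Py _]; apply: P0; exists y.
Qed.

Lemma cluster_valuation (X : topologicalType) (K V : Type)
    (A : K -> set X) (w : K -> set (formula V)) :
  partition [set: K] A [set: X] ->
  (forall k U, open U -> U !=set0 -> ~ meager (A k `&` U)) ->
  (forall k, ultra (w k)) -> (forall k f, w k (Dia f) <-> exists l, w l f) ->
  exists v : V -> baire_algebra X, forall f,
    eval v f = baire_class (\bigcup_(k in [set k | w k f]) A k).
Proof.
move=> [covA trivA A0] nmA uw wDia.
pose S f := \bigcup_(k in [set k | w k f]) A k.
have SE k x f : A k x -> S f x <-> w k f.
  move=> Akx; split=> [[l wl Alx]|wk]; last by exists k.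
  by rewrite (trivA k l) //; exists x.
have Aex x : exists k, A k x.
  have [k _ Ak] : cover [set: K] A x by rewrite covA.
  by exists k.
exists (fun p => baire_class (S (Var p))).
elim=> [//|g /= -> h ->|g /= ->|g /= ->].
- rewrite [LHS]baire_meetE -/(S _); congr baire_class; apply/predeqP => x.
  have [k Ak] := Aex x; have {}SE f := SE k x f Ak.
  split=> [[/SE wg /SE wh]|/SE/(uw k).1[/SE Sg /SE Sh]//].
  by apply/SE/(uw k).1.
- rewrite [LHS]baire_complE -/(S _); congr baire_class; apply/predeqP => x.
  have [k Ak] := Aex x; have {}SE f := SE k x f Ak.
  split=> [nSg|/SE/(uw k).2 nwg /SE//].
  by apply/SE/(uw k).2 => /SE.
rewrite clop_class; congr baire_class.
have [[l wl]|nwl] := pselect (exists l, w l g).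
  apply/seteqP; split=> x _; have [k Ak] := Aex x.
    by exists k => //=; apply/wDia; exists l.
  move=> [U [oU mU] Ux]; apply: (nmA l U) => //; first by exists x.
  by apply: meagerS mU => y [Ay Uy]; split=> //; exists l.
apply/seteqP; split=> x.
  case; exists setT => //; split; first exact: openT.
  by apply: meagerS meager0 => y [[l wl]]; case: nwl; exists l.
by move=> [k /= /wDia].
Qed.

Lemma cluster_strongly_complete (X : topologicalType) (K V : Type)
    (L : set (formula V)) :
  [set: K] !=set0 -> baire_resolvable K X ->
  (forall G, S5_theory (derivable L G)) ->
  (forall T w0 : set (formula V),
     L `<=` T -> S5_theory T -> T `<=` w0 -> ultra w0 ->
     exists w : K -> set (formula V), (forall k, S5_cluster T w0 (w k)) /\
       (forall f, w0 (Dia f) -> exists k, w k f)) ->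
  strongly_complete (baire_algebra X) L.
Proof.
move=> [k0 _] [A partA nmA] ST enum G f Gf; apply: contrapT => nf.
have {}ST := ST G; have [w0 [Tw0 uw0 nw0f]] := lindenbaum ST.1 nf.
have LT : L `<=` derivable L G by move=> g; exact: der_thm.
have [w [Cw ww]] := enum _ _ LT ST Tw0 uw0.
have uw k : ultra (w k) by have [] := Cw k.
have wDia k g : w k (Dia g) <-> exists l, w l g.
  have [_ _ ->] := Cw k; split; first exact: ww.
  by move=> [l wl]; exact: cluster_Dia ST (Cw l) wl.
have [v vP] := cluster_valuation partA nmA uw wDia.
have [covA trivA A0] := partA.
have : eval v f = \top%O.
  apply: Gf => g Gg; rewrite vP; apply/baire_class_top.
  apply: meagerS meager0 => x; apply.
  have [k _ Ak] : cover [set: K] A x by rewrite covA.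
  by exists k => //=; have [Tw _ _] := Cw k; apply/Tw/der_prem.
have [k wk] : exists k, w k (Neg f).
  by apply: ww; apply: (cluster_Dia ST (cluster_refl Tw0 uw0)); apply/uw0.2.
rewrite vP => /baire_class_top mf.
apply: (nmA k setT); first exact: openT.
  by have [x _] := A0 k I; exists x.
apply: meagerS mf => x [Akx _] [l wl Alx].
have kl : k = l by apply: trivA => //; exists x.
by move: wk; rewrite (uw k).2 kl.
Qed.

(* The cardinal lambda is the cardinality of the type K, and lambda + 1 that of
   option K. *)
Theorem theorem5p10 (X : topologicalType) (K : Type) :
  baire_space X -> [set: K] !=set0 -> baire_resolvable K X ->
  (infinite_set [set: K] ->
     sound (baire_algebra X) (S5 K) /\
     strongly_complete (baire_algebra X) (S5 K)) /\
  (forall n : nat, [set: K] #= `I_n ->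
     (forall U : set X, open U -> U !=set0 ->
        ~ baire_resolvable (option K) (set_type U)) ->
     sound (baire_algebra X) (S5_bounded n) /\
     strongly_complete (baire_algebra X) (S5_bounded n)).
Proof.
move=> _ K0 resX; split=> [Kinf|n Kn nres]; split.
- by apply: theorems_sound => f; exact: S5_axiom_valid.
- have [p p_inj] := infinite_nat_injection Kinf.
  have p01 : p 0 <> p 1 by move=> /p_inj.
  apply: (cluster_strongly_complete K0 resX).
    by move=> G; exact: derivable_S5_theory p01 _.
  by move=> T w0 _; exact: cluster_enum_infinite.
- apply: theorems_sound => f [|->]; first exact: S5_axiom_valid.
  exact: bounded_axiom_valid Kn nres.
- apply: (cluster_strongly_complete K0 resX).
    move=> G; apply: (@derivable_S5_theory _ 0 1) => // f; left.
  move=> T w0 LT ST Tw0 uw0; apply: (cluster_enum_bounded Kn K0 ST Tw0 uw0).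
  by move=> s; apply/LT/thm_subst/thm_ax; right.
Qed.
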